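(* Let $X=\{\{X_{k,n},\ 1\le k\le k(n)\},\ n\ge1\}$ be an array of random variables defined on the same probability space, with $k(n)\to+\infty$, such that each row $\{X_{k,n},1\le k\le k(n)\}$ is stationary and associated. Let $(m(n),\ell(n),r(n))_{n\ge1}$ be sequences of non-negative integers with $k(n)=m(n)\ell(n)+r(n)$, $1\le m(n)\to+\infty$, $0\le r(n)<\ell(n)$ and $\ell(n)/m(n)\to0$. Suppose that: (i) for all $1\le k\le k(n)$, $X_{k,n}$ has the Bernoulli law $\mathcal B(p_n)$ with $0<p_n<1$; (ii) $p_n\to0$ and $k(n)p_n\to\lambda_1>0$ as $n\to+\infty$; (iii) $2\sum_{j=2}^{k(n)}(k(n)-j+1)\,\mathrm{Cov}(X_{1,n},X_{j,n})\to\lambda_2$ with $\lambda_2=0$, and $m(n)\ell(n)^2\sup_{2\le j\le k(n)}\mathrm{Cov}(X_{1,n},X_{j,n})\to0$. Then $S_n[X]=\sum_{k=1}^{k(n)}X_{k,n}$ converges weakly to the Poisson law $\mathcal P(\lambda_1)$.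
   Context: Random variables $Z_1,\dots,Z_n$ are associated if for any coordinate-wise non-decreasing functions $h,g:\mathbb R^n\to\mathbb R$ one has $\mathrm{Cov}(h(Z_1,\dots,Z_n),g(Z_1,\dots,Z_n))\ge0$ (whenever the covariance exists). A row is stationary if its finite-dimensional laws are invariant under index shifts within the row. $\mathcal B(p)$ is the law with $\mathbb P(X=1)=p=1-\mathbb P(X=0)$. *)

(* Defs.v *)
From HB Require Import structures.
From mathcomp Require Import all_boot all_order all_algebra.
From mathcomp Require Import all_classical all_reals all_analysis.
Set Implicit Arguments.
Unset Strict Implicit.
Unset Printing Implicit Defensive.
Import Order.TTheory GRing.Theory Num.Theory.
Import numFieldNormedType.Exports.

Local Open Scope classical_set_scope.
Local Open Scope ring_scope.

(* Existence of the covariance means that the two variables and their product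
   are integrable; this includes the measurability of [h \o Z] and [g \o Z],
   so [h] and [g] themselves are not required to be Borel. *)
Definition associated (d : measure_display) (T : measurableType d)
    (R : realType) (P : probability T R) (N : nat)
    (Z : 'I_N -> {RV P >-> R}) : Prop :=
  forall h g : N.-tuple R -> R,
    let nondecr (f : N.-tuple R -> R) :=
      forall x y : N.-tuple R,
        (forall i, tnth x i <= tnth y i) -> f x <= f y in
    let hZ (w : T) : R := h [tuple Z i w | i < N] in
    let gZ (w : T) : R := g [tuple Z i w | i < N] in
    nondecr h -> nondecr g ->
    hZ \in Lfun P 1 -> gZ \in Lfun P 1 -> (hZ * gZ)%R \in Lfun P 1 ->
    (0 <= covariance P hZ gZ)%E.

(* For every finite family of indices [i] and every shift [s] keeping it inside
   the row ([j] being the shifted family), the random vectors [Z_i] and [Z_j]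
   have the same law on R^q. *)
Definition stationary (d : measure_display) (T : measurableType d)
    (R : realType) (P : probability T R) (N : nat)
    (Z : 'I_N -> {RV P >-> R}) : Prop :=
  forall (q s : nat) (i j : 'I_q -> 'I_N),
    (forall a, j a = (i a + s)%N :> nat) ->
    forall A : set (q.-tuple R), measurable A ->
      pushforward P (fun w => [tuple Z (j a) w | a < q]) A =
      pushforward P (fun w => [tuple Z (i a) w | a < q]) A.

Definition has_bernoulli_law (d : measure_display) (T : measurableType d)
    (R : realType) (P : probability T R) (Z : {RV P >-> R}) (p : R) : Prop :=
  distribution P Z [set 1] = p%:E /\ distribution P Z [set 0] = (1 - p)%:E.

Definition natR (R : realType) (j : nat) : R := j%:R.

Lemma measurable_natR (R : realType) : measurable_fun setT (@natR R).
Proof. by []. Qed.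

HB.instance Definition _ (R : realType) :=
  isMeasurableFun.Build _ _ nat R (@natR R)
    (@measurable_natR R).

(* The Poisson law as a probability on the real line. The second argument of
   [poisson_prob] is not used by its definition. *)
Definition poisson_law (R : realType) (rate : R) :
    probability R R :=
  distribution (poisson_prob rate 0) (@natR R).

Definition cvg_weakly (R : realType)
    (mu : nat -> probability R R)
    (nu : probability R R) : Prop :=
  forall f : R -> R, continuous f -> (exists M : R, forall x, `|f x| <= M) ->
    (\int[mu n]_x (f x)%:E)%E @[n --> \oo] --> (\int[nu]_x (f x)%:E)%E.

(* The columns of the array are numbered from 1; values [X j n] with [j = 0] or
   [j > k n] do not belong to row [n]. *)
Definition array_row (d : measure_display) (T : measurableType d)
    (R : realType) (P : probability T R) (X : nat -> nat -> {RV P >-> R})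
    (k : nat -> nat) (n : nat) : 'I_(k n) -> {RV P >-> R} :=
  fun i => X i.+1 n.
Arguments array_row {d T R P} X k n.

Definition row_sum (d : measure_display) (T : measurableType d)
    (R : realType) (P : probability T R) (X : nat -> nat -> {RV P >-> R})
    (k : nat -> nat) (n : nat) : T -> R :=
  fun w => \sum_(1 <= j < (k n).+1) X j n w.

Lemma measurable_row_sum (d : measure_display) (T : measurableType d)
    (R : realType) (P : probability T R) (X : nat -> nat -> {RV P >-> R})
    (k : nat -> nat) (n : nat) : measurable_fun setT (row_sum X k n).
Proof. by apply: measurable_sum => j; exact: measurable_funPT. Qed.

HB.instance Definition _ (d : measure_display) (T : measurableType d)
    (R : realType) (P : probability T R) (X : nat -> nat -> {RV P >-> R})
    (k : nat -> nat) (n : nat) :=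
  isMeasurableFun.Build _ _ T R (row_sum X k n)
    (@measurable_row_sum d T R P X k n).

(* Main.v *)
Require Import Defs.
From HB Require Import structures.
From mathcomp Require Import all_boot all_order all_algebra.
From mathcomp Require Import all_classical all_reals all_analysis.
From mathcomp Require Import measurable_realfun.
From mathcomp Require Import ring lra zify.
Set Implicit Arguments.
Unset Strict Implicit.
Unset Printing Implicit Defensive.
Import Order.TTheory GRing.Theory Num.Theory.
Import numFieldNormedType.Exports.

Local Open Scope classical_set_scope.
Local Open Scope ring_scope.

(** Why the sum is asymptotically Poisson. Almost surely each variable of a row
    equals the indicator that it is at least 1, so the sum of a row of length
    N may be replaced by the number of these hits, which takes values in nat.
    Compare it with a binomial variable by revealing the hits one at a time:
    if U is the number of hits among the first j variables and B the next
    indicator, then for every f : nat -> R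

      E f(U + B) = E [f(U) + p (f(U + 1) - f(U))]
                   + Cov (f(U + 1) - f(U), B)

    ([mean_hitsS]). Without the covariance this is the recursion satisfied by
    sums of independent Bernoulli variables, whose solution is the binomial
    expectation ([iter_bernoulli_step]).

    Association controls the covariance. If g is L-Lipschitz on nat, then
    L U + g(U) and L U - g(U) are both nondecreasing functions of the row, hence
    nonnegatively correlated with B, and
    |Cov (g(U), B)| <= L Cov (U, B) ([rcov_hits_lipschitz]); here Cov (U, B) is
    a sum of covariances of pairs. For f bounded by M, g = f(. + 1) - f is
    4M-Lipschitz, and summing over the row gives ([mean_hits_bernoulli])

      |E f(S) - E f(Bin(N, p))| <= 4 M \sum_(a < i < N) Cov (X_a, X_i).

    By stationarity the right-hand side is 2 M times the weighted sum of
    covariances assumed to tend to 0 ([sum_rcov_hit]). What remains is the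
    classical convergence of binomial to Poisson expectations
    ([cvg_binomial_poisson]), proved by dominated convergence on nat. *)

(** * Binomial expectations as iterated Bernoulli steps *)

(** This is u |-> E f(u + B) for B a Bernoulli variable of parameter p. *)
Definition bernoulli_step (R : realType) (p : R) (f : nat -> R) : nat -> R :=
  fun u => f u + p * (f u.+1 - f u).

Lemma binomial_pmfE (R : realType) (N j : nat) (p : R) :
  binomial_pmf N p j = p ^+ j * (1 - p) ^+ (N - j) *+ 'C(N, j).
Proof. by []. Qed.

Lemma binomial_pmf0S (R : realType) (N : nat) (p : R) :
  binomial_pmf N.+1 p 0 = (1 - p) * binomial_pmf N p 0.
Proof. by rewrite !binomial_pmfE !bin0 !expr0 !subn0 !mul1r !mulr1n exprS. Qed.

Lemma binomial_pmfSS (R : realType) (N j : nat) (p : R) : (j <= N)%N ->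
  binomial_pmf N.+1 p j.+1 =
  (1 - p) * binomial_pmf N p j.+1 + p * binomial_pmf N p j.
Proof.
move=> jN; rewrite !binomial_pmfE binS subSS mulrnDr exprS.
rewrite [X in _ = _ + X]mulrnAr mulrA; congr (_ + _).
have [->|jN'] := eqVneq j N; first by rewrite bin_small// !mulr0n mulr0.
rewrite mulrnAr; congr (_ *+ _).
have -> : (N - j = (N - j.+1).+1)%N by lia.
by rewrite exprS; ring.
Qed.

Lemma binomial_pmf_gt (R : realType) (N j : nat) (p : R) : (N < j)%N ->
  binomial_pmf N p j = 0.
Proof. by move=> Nj; rewrite binomial_pmfE bin_small// mulr0n. Qed.

(** Conditioning on the first of N independent Bernoulli variables: the
    induction is Pascal's rule for the binomial weights. *)
Lemma iter_bernoulli_step (R : realType) (p : R) (N : nat) (f : nat -> R) u :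
  iter N (bernoulli_step p) f u =
  \sum_(j < N.+1) binomial_pmf N p j * f (u + j)%N.
Proof.
elim: N f u => [|N IH] f u.
  by rewrite big_ord1 binomial_pmfE bin0 !expr0 mulr1 mulr1n mul1r addn0.
rewrite iterSr IH [RHS]big_ord_recl binomial_pmf0S addn0.
under eq_bigr do rewrite /bernoulli_step.
rewrite (eq_bigr (fun i : 'I_N.+1 =>
    (1 - p) * (binomial_pmf N p i * f (u + i)%N)
  + p * binomial_pmf N p i * f (u + i.+1)%N)); last first.
  by move=> i _; rewrite addnS; ring.
rewrite big_split/= -mulr_sumr big_ord_recl/= addn0 mulrDr mulrA -addrA.
congr (_ + _); rewrite [RHS](eq_bigr (fun i : 'I_N.+1 =>
    (1 - p) * (binomial_pmf N p i.+1 * f (u + i.+1)%N) +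
    p * binomial_pmf N p i * f (u + i.+1)%N)); last first.
  by move=> i _; rewrite binomial_pmfSS -1?ltnS// mulrDl mulrA.
rewrite big_split/=; congr (_ + _); rewrite -mulr_sumr big_ord_recr/=.
by rewrite binomial_pmf_gt// mul0r addr0.
Qed.

(** For p in [0, 1] a step is an average of two values of f. *)
Lemma bernoulli_step_bounded (R : realType) (p M : R) (f : nat -> R) :
  0 <= p <= 1 -> (forall u, `|f u| <= M) ->
  forall u, `|bernoulli_step p f u| <= M.
Proof.
move=> /andP[p0 p1] fM u; rewrite /bernoulli_step.
have := fM u; have := fM u.+1; rewrite !ler_norml => /andP[a b] /andP[c e].
by apply/andP; split; nra.
Qed.

(** * From binomial to Poisson *)

(** Squeezed by exp(- p / (1 - p)) <= 1 - p <= exp(- p), both instances of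
    1 + x <= exp(x), raised to the power k. *)
Lemma cvg_onem_exprn (R : realType) (k : nat -> nat) (p : nat -> R) (l : R) :
  (forall n, 0 < p n < 1) -> p n @[n --> \oo] --> (0 : R) ->
  ((k n)%:R * p n) @[n --> \oo] --> l ->
  ((1 - p n) ^+ k n) @[n --> \oo] --> expR (- l).
Proof.
move=> p01 p0 kp.
apply: (@squeeze_cvgr _ _ _ _
   (fun n => expR (- ((k n)%:R * p n * (1 - p n)^-1)))
   (fun n => expR (- ((k n)%:R * p n)))).
- near=> n; have /andP[pn0 pn1] := p01 n; apply/andP; split.
    rewrite -mulrA -mulrN expRM_natl lerXn2r ?nnegrE ?expR_ge0//; first lra.
    rewrite expRN -[leRHS]invrK lef_pV2 ?posrE ?expR_gt0 ?invr_gt0; [|lra..].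
    apply: le_trans (expR_ge1Dx _); rewrite le_eqVlt; apply/orP; left.
    by apply/eqP; field; lra.
  rewrite -mulrN expRM_natl lerXn2r ?nnegrE ?expR_ge0//; first lra.
  exact: expR_ge1Dx.
- apply: continuous_cvg; first exact: continuous_expR.
  apply: cvgN; rewrite -[l]mulr1 -[in X in _ --> X]invr1.
  apply: cvgM => //; apply: cvgV; first exact: oner_neq0.
  by rewrite -[X in _ --> X]subr0; apply: cvgB => //; exact: cvg_cst.
- apply: continuous_cvg; first exact: continuous_expR.
  exact: cvgN.
Unshelve. all: by end_near. Qed.

(** Each of the j factors (k - i) p = k p - i p tends to l. *)
Lemma cvg_ffact (R : realType) (k : nat -> nat) (p : nat -> R) (l : R) j :
  k n @[n --> \oo] --> \oo -> p n @[n --> \oo] --> (0 : R) ->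
  ((k n)%:R * p n) @[n --> \oo] --> l ->
  (((k n) ^_ j)%:R * p n ^+ j) @[n --> \oo] --> l ^+ j.
Proof.
move=> koo p0 kp; elim: j => [|j IH].
  by under eq_fun do rewrite ffactn0 expr0 mulr1; exact: cvg_cst.
rewrite exprSr.
have step : (((k n) ^_ j)%:R * p n ^+ j * ((k n)%:R * p n - j%:R * p n))
    @[n --> \oo] --> l ^+ j * l.
  apply: cvgM => //; rewrite -[X in _ --> X]subr0; apply: cvgB => //.
  by rewrite -[X in _ --> X](mulr0 j%:R); apply: cvgM => //; exact: cvg_cst.
apply: cvg_trans step; apply: near_eq_cvg; near=> n.
have jk : (j <= k n)%N.
  by near: n; exact: (koo _ (nbhs_infty_ge j)).
by rewrite ffactnSr natrM natrB// exprSr; ring.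
Unshelve. all: by end_near. Qed.

(** This form separates the three factors that converge on their own when
    k p tends to l. *)
Lemma binomial_pmf_ffact (R : realType) (N j : nat) (p : R) :
  binomial_pmf N p j = (N ^_ j)%:R * p ^+ j * (1 - p) ^+ (N - j) / j`!%:R.
Proof.
have fj : j`!%:R != 0 :> R by rewrite pnatr_eq0 -lt0n fact_gt0.
rewrite binomial_pmfE -mulr_natr -bin_ffact natrM; by field.
Qed.

Lemma cvg_binomial_pmf (R : realType) (k : nat -> nat) (p : nat -> R)
    (l : R) j :
  0 < l -> k n @[n --> \oo] --> \oo ->
  (forall n, 0 < p n < 1) -> p n @[n --> \oo] --> (0 : R) ->
  ((k n)%:R * p n) @[n --> \oo] --> l ->
  binomial_pmf (k n) (p n) j @[n --> \oo] --> poisson_pmf l j.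
Proof.
move=> l0 koo p01 p0 kp; rewrite /poisson_pmf l0.
have q1 : (1 - p n) @[n --> \oo] --> (1 : R).
  by rewrite -[X in _ --> X]subr0; apply: cvgB => //; exact: cvg_cst.
have qj : ((1 - p n) ^+ j) @[n --> \oo] --> (1 : R).
  by have := cvg_comp _ _ q1 (@exprn_continuous R j 1); rewrite expr1n; apply.
have qV : ((1 - p n) ^+ j)^-1 @[n --> \oo] --> (1 : R).
  by rewrite -[X in _ --> X]invr1; apply: cvgV => //; exact: oner_neq0.
have lim : (((k n) ^_ j)%:R * p n ^+ j *
    ((1 - p n) ^+ k n * ((1 - p n) ^+ j)^-1)
    / j`!%:R) @[n --> \oo] --> l ^+ j * (expR (- l) * 1) / j`!%:R.
  apply: cvgMl; apply: cvgM; first exact: cvg_ffact.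
  by apply: cvgM => //; exact: cvg_onem_exprn.
rewrite mulr1 mulrAC in lim; apply: cvg_trans lim; apply: near_eq_cvg; near=> n.
have jk : (j <= k n)%N.
  by near: n; exact: (koo _ (nbhs_infty_ge j)).
rewrite binomial_pmf_ffact; congr (_ * _ / _).
have /andP[pn0 pn1] := p01 n.
by rewrite -{1}(subnK jk) exprD mulfK// expf_neq0//; lra.
Unshelve. all: by end_near. Qed.

Lemma ffact_le_expn N j : (N ^_ j <= N ^ j)%N.
Proof.
by elim: j => // j IH; rewrite ffactnSr expnSr leq_mul// leq_subr.
Qed.

(** A summable bound independent of N and p as long as N p stays bounded; it is
    the dominating function of the Poisson limit. *)
Lemma binomial_pmf_le (R : realType) (N j : nat) (p C : R) :
  0 <= p <= 1 -> N%:R * p <= C -> binomial_pmf N p j <= exp_coeff C j.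
Proof.
move=> /andP[p0 p1] NC; rewrite binomial_pmf_ffact /exp_coeff/=.
rewrite ler_wpM2r ?invr_ge0//.
rewrite (@le_trans _ _ ((N ^_ j)%:R * p ^+ j))//.
  by rewrite ler_piMr ?mulr_ge0 ?exprn_ge0// exprn_ile1//; lra.
rewrite (@le_trans _ _ ((N%:R * p) ^+ j))//.
  by rewrite exprMn ler_wpM2r ?exprn_ge0// -natrX ler_nat ffact_le_expn.
by rewrite lerXn2r ?nnegrE ?mulr_ge0// (le_trans _ NC)// mulr_ge0.
Qed.

Lemma poisson_prob_mseries (R : realType) (l : R) : 0 < l ->
  poisson_prob l 0 = mseries (fun j => mscale (NngNum (poisson_pmf_ge0 l j))
    (\d_j : {measure set nat -> \bar R})) 0 :> (set nat -> \bar R).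
Proof.
move=> l0; apply/funext => U; rewrite /poisson_prob l0 /mseries.
rewrite esum_mkcond -nneseries_esumT.
  apply: eq_eseriesr => j _; rewrite -[RHS]/(_ * \d_j U)%E diracE.
  by case: ifPn => _; rewrite ?mule1 ?mule0.
by move=> j; case: ifPn => // _; rewrite lee_fin poisson_pmf_ge0.
Qed.

(** Poisson and binomial expectations are both written as integrals for the
    counting measure, where dominated convergence compares them. *)
Lemma ge0_integral_poisson (R : realType) (l : R) (f : nat -> R) :
  0 < l -> (forall j, 0 <= f j) ->
  (\int[poisson_prob l 0]_j (f j)%:E =
   \int[counting]_j (poisson_pmf l j * f j)%:E)%E.
Proof.
move=> l0 f0; rewrite ge0_integral_count; last first.
  by move=> j; rewrite lee_fin mulr_ge0 ?poisson_pmf_ge0.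
transitivity (\int[mseries (fun j => mscale (NngNum (poisson_pmf_ge0 l j))
    (\d_j : {measure set nat -> \bar R})) 0]_j (f j)%:E)%E.
  by congr (integral _ _ _); apply/funext => U /=; rewrite poisson_prob_mseries.
rewrite ge0_integral_measure_series//=; last by move=> t _; rewrite lee_fin.
apply: eq_eseriesr => j _; rewrite ge0_integral_mscale//=; last first.
  by move=> t _; rewrite lee_fin.
by rewrite integral_dirac// diracT mul1e EFinM.
Qed.

(** Bernoulli steps fix the constant function 1. *)
Lemma sum_binomial_pmf (R : realType) (N : nat) (p : R) :
  \sum_(j < N.+1) binomial_pmf N p j = 1.
Proof.
rewrite -[RHS](_ : iter N (bernoulli_step p) (fun=> 1) 0%N = 1).
  by rewrite iter_bernoulli_step; apply: eq_bigr => j _; rewrite mulr1.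
have : forall u, iter N (bernoulli_step p) (fun=> 1 : R) u = 1.
  elim: N => // N IH u.
  by rewrite iterS /bernoulli_step !IH subrr mulr0 addr0.
exact.
Qed.

Lemma integral_count_binomial (R : realType) (N : nat) (p : R) (f : nat -> R) :
  0 <= p <= 1 -> (forall j, 0 <= f j) ->
  (\int[counting]_j (binomial_pmf N p j * f j)%:E =
   (\sum_(j < N.+1) binomial_pmf N p j * f j)%:E)%E.
Proof.
move=> p01 f0.
have bf0 j : (0 <= (binomial_pmf N p j * f j)%:E)%E.
  by rewrite lee_fin mulr_ge0 ?binomial_pmf_ge0.
rewrite ge0_integral_count// (nneseries_split 0 N.+1)// add0n big_mkord sumEFin.
rewrite [X in (_ + X)%E]eseries0 ?adde0// => j Nj _.
by rewrite binomial_pmf_gt// mul0r.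
Qed.

Lemma integrable_exp_coeff (R : realType) (C : R) : 0 <= C ->
  (counting : {measure set nat -> \bar R}).-integrable setT
    (fun j => (exp_coeff C j)%:E).
Proof.
move=> C0; have e0 j : 0 <= exp_coeff C j by rewrite exp_coeff_ge0.
apply/integrableP; split=> //.
under eq_integral do rewrite gee0_abs ?lee_fin ?e0//.
rewrite ge0_integral_count//.
have := is_cvg_series_exp_coeff C => /cvg_ex[l cl].
rewrite (_ : (\sum_(0 <= k <oo) _)%E = l%:E) ?ltry//.
apply/cvg_lim => //; apply: cvg_EFin => //=.
  by near=> n; rewrite sumEFin.
apply: cvg_trans cl; apply: near_eq_cvg; near=> n.
by rewrite /= sumEFin.
Unshelve. all: by end_near. Qed.

Section binomial_poisson.
Variables (R : realType) (k : nat -> nat) (p : nat -> R) (l : R).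
Hypotheses (l0 : 0 < l) (koo : k n @[n --> \oo] --> \oo)
  (p01 : forall n, 0 < p n < 1) (p0 : p n @[n --> \oo] --> (0 : R))
  (kp : ((k n)%:R * p n) @[n --> \oo] --> l).

Let p01' n : 0 <= p n <= 1.
Proof. by case/andP: (p01 n) => a b; rewrite !ltW. Qed.

(** The sign restriction makes every integral over nat a series of nonnegative
    terms. *)
Lemma ge0_cvg_binomial_poisson (f : nat -> R) (M : R) :
  (forall j, 0 <= f j <= M) ->
  (\sum_(j < (k n).+1) binomial_pmf (k n) (p n) j * f j)%:E @[n --> \oo]
    --> (\int[poisson_prob l 0]_j (f j)%:E)%E.
Proof.
move=> fM; have f0 j : 0 <= f j by case/andP: (fM j).
rewrite ge0_integral_poisson//.
under eq_fun do rewrite -integral_count_binomial//.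
have [C kpC] : exists C, forall n, (k n)%:R * p n <= C.
  have /cvg_seq_bounded[C [_ /(_ (C + 1))]] : cvgn (fun n => (k n)%:R * p n).
    by apply/cvg_ex; exists l.
  rewrite ltrDl ltr01 => /(_ erefl) H; exists (C + 1) => n.
  by apply: le_trans (ler_norm _) _; exact: H.
have C0 : 0 <= C.
  by apply: le_trans (kpC 0%N); rewrite mulr_ge0//; case/andP: (p01' 0%N).
have M0 : 0 <= M by case/andP: (fM 0%N) => a b; exact: le_trans b.
have [] // := @dominated_convergence _ _ _
    (counting : {measure set nat -> \bar R}) setT measurableT
    (fun n j => (binomial_pmf (k n) (p n) j * f j)%:E)
    (fun j => (poisson_pmf l j * f j)%:E)
    (fun j => (M%:E * (exp_coeff C j)%:E)%E).
- apply: aeW => j _; apply: cvg_EFin; first by near=> n.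
  by apply: cvgMl; exact: cvg_binomial_pmf.
- by apply: integrableZl => //; exact: integrable_exp_coeff.
- apply: aeW => j n _; rewrite gee0_abs ?lee_fin; last first.
    by rewrite mulr_ge0 ?binomial_pmf_ge0.
  rewrite mulrC ler_pM ?binomial_pmf_ge0//.
    by case/andP: (fM j).
  exact: binomial_pmf_le.
Unshelve. all: by end_near. Qed.

(** Reduction to the nonnegative case by adding M to f; both laws have total
    mass 1, so both sides are shifted by M. *)
Lemma cvg_binomial_poisson (f : nat -> R) (M : R) :
  (forall j, `|f j| <= M) ->
  (\sum_(j < (k n).+1) binomial_pmf (k n) (p n) j * f j)%:E @[n --> \oo]
    --> (\int[poisson_prob l 0]_j (f j)%:E)%E.
Proof.
move=> fM.
have int_f : (poisson_prob l 0).-integrable setT (EFin \o f).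
  apply: measurable_bounded_integrable => //.
    by rewrite [ltLHS](@probability_setT _ _ _ (poisson_prob l 0)) ltry.
  exists M; split; rewrite ?num_real// => x Mx y _ /=.
  by rewrite (le_trans (fM y))// ltW.
have := @ge0_cvg_binomial_poisson (fun j => f j + M) (M + M).
have -> : (\int[poisson_prob l 0]_j (f j + M)%:E =
    \int[poisson_prob l 0]_j (f j)%:E + M%:E)%E.
  under eq_integral do rewrite EFinD.
  rewrite integralD//; last exact: finite_measure_integrable_cst.
  rewrite integral_cst//.
  by rewrite [X in (_ * X)%E](@probability_setT _ _ _ (poisson_prob l 0)) mule1.
have fin_f : (\int[poisson_prob l 0]_j (f j)%:E)%E \is a fin_num.
  exact: integrable_fin_num.
move=> H; have {}H := H _.
have /H : forall j, 0 <= f j + M <= M + M.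
  move=> j; have := fM j; rewrite ler_norml => /andP[a b].
  by apply/andP; split; lra.
move=> H'; rewrite -(addeK (\int[poisson_prob l 0]_j (f j)%:E)%E
  (_ : M%:E \is a fin_num))//.
have MM : ((\int[poisson_prob l 0]_j (f j)%:E + M%:E) +? - M%:E)%E.
  by rewrite fin_num_adde_defl.
have lim := cvgeB MM H' (@cvg_cst _ M%:E _ \oo _).
apply: cvg_trans (lim _ _); apply: near_eq_cvg; near=> n => /=.
rewrite -EFinB; congr EFin; under eq_bigr do rewrite mulrDr.
by rewrite big_split/= -mulr_suml sum_binomial_pmf mul1r addrK.
Unshelve. all: by end_near. Qed.

End binomial_poisson.

(** * Real-valued expectation and covariance *)

Section expectation_bounded.
Context (d : measure_display) (T : measurableType d) (R : realType)
  (P : probability T R).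

(** A class stable under products, on which every expectation and covariance is
    finite. *)
Definition bounded_measurable (g : T -> R) : Prop :=
  measurable_fun setT g /\ exists M, forall w, `|g w| <= M.

Definition mean (g : T -> R) : R := \int[P]_w g w.

Definition rcov (g h : T -> R) : R :=
  mean (fun w => g w * h w) - mean g * mean h.

Lemma bounded_measurable_cst c : bounded_measurable (fun=> c).
Proof. by split=> //; exists `|c|. Qed.

Lemma bounded_measurableM g h : bounded_measurable g -> bounded_measurable h ->
  bounded_measurable (fun w => g w * h w).
Proof.
move=> [mg [M gM]] [mh [K hK]]; split; first exact: measurable_funM.
by exists (M * K) => w; rewrite normrM ler_pM.
Qed.

Lemma bounded_measurable_integrable g : bounded_measurable g ->
  P.-integrable setT (EFin \o g).
Proof.
move=> [mg [M gM]]; apply: measurable_bounded_integrable => //.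
  by rewrite [ltLHS](@probability_setT _ _ _ P) ltry.
exists M; split; rewrite ?num_real// => x Mx y _ /=.
by rewrite (le_trans (gM y))// ltW.
Qed.

Lemma bounded_measurable_Lfun g : bounded_measurable g -> g \in Lfun P 1.
Proof. by move=> /bounded_measurable_integrable/Lfun1_integrable. Qed.

Lemma expectation_mean g : bounded_measurable g -> ('E_P[g] = (mean g)%:E)%E.
Proof.
move=> bg; rewrite /mean /Rintegral fineK; first by rewrite unlock.
exact/integrable_fin_num/bounded_measurable_integrable.
Qed.

Lemma meanD g h : bounded_measurable g -> bounded_measurable h ->
  mean (fun w => g w + h w) = mean g + mean h.
Proof.
move=> bg bh.
by rewrite /mean RintegralD//; exact: bounded_measurable_integrable.
Qed.

Lemma meanZ c g : bounded_measurable g -> mean (fun w => c * g w) = c * mean g.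
Proof.
move=> bg.
by rewrite /mean RintegralZl//; exact: bounded_measurable_integrable.
Qed.

Lemma covariance_rcov g h : bounded_measurable g -> bounded_measurable h ->
  covariance P g h = (rcov g h)%:E.
Proof.
move=> bg bh; have bgh := bounded_measurableM bg bh.
by rewrite covarianceE ?bounded_measurable_Lfun// !expectation_mean.
Qed.

Lemma rcovDl g g' h : bounded_measurable g -> bounded_measurable g' ->
  bounded_measurable h ->
  rcov (fun w => g w + g' w) h = rcov g h + rcov g' h.
Proof.
move=> bg bg' bh; rewrite /rcov meanD//.
under eq_fun do rewrite mulrDl.
by rewrite meanD; [ring|exact: bounded_measurableM..].
Qed.

Lemma rcovZl c g h : bounded_measurable g -> bounded_measurable h ->
  rcov (fun w => c * g w) h = c * rcov g h.
Proof.
move=> bg bh; rewrite /rcov meanZ//; under eq_fun do rewrite -mulrA.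
by rewrite meanZ; [ring|exact: bounded_measurableM].
Qed.

Lemma rcov_cstl c h : bounded_measurable h -> rcov (fun=> c) h = 0.
Proof.
move=> bh; rewrite /rcov meanZ// /mean Rintegral_cst//.
by rewrite [X in fine X](@probability_setT _ _ _ P) mulr1 subrr.
Qed.

Lemma expectation_ae_eq (U V : T -> R) : measurable_fun setT U ->
  measurable_fun setT V -> {ae P, forall w, U w = V w} -> ('E_P[U] = 'E_P[V])%E.
Proof.
move=> mU mV UV; rewrite unlock; apply: ae_eq_integral => //.
- exact/measurable_EFinP.
- exact/measurable_EFinP.
- by apply: filterS UV => w /= ->.
Qed.

(** This replaces the variables of a row by indicators, whose covariances are
    finite. *)
Lemma covariance_ae_eq (X Y g h : T -> R) :
  measurable_fun setT X -> measurable_fun setT Y ->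
  bounded_measurable g -> bounded_measurable h ->
  {ae P, forall w, X w = g w} -> {ae P, forall w, Y w = h w} ->
  covariance P X Y = (rcov g h)%:E.
Proof.
move=> mX mY bg bh Xg Yh; have [mg _] := bg; have [mh _] := bh.
rewrite -covariance_rcov// unlock (expectation_ae_eq mX mg Xg)
  (expectation_ae_eq mY mh Yh).
apply: expectation_ae_eq => /=.
- by apply: measurable_funM; apply: measurable_funB.
- by apply: measurable_funM; apply: measurable_funB.
- by apply: filterS2 Xg Yh => w /= Xw Yw; rewrite !fctE /= Xw Yw.
Qed.

Lemma integral_distribution_mean (Y : {RV P >-> R}) (f : R -> R) :
  measurable_fun setT f -> (exists M, forall x, `|f x| <= M) ->
  (\int[distribution P Y]_x (f x)%:E = (mean (f \o Y))%:E)%E.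
Proof.
move=> mf [M fM].
have bfY : bounded_measurable (f \o Y).
  by split; [exact: measurableT_comp|exists M => w; exact: fM].
rewrite integral_distribution//; [|exact/measurable_EFinP|
  exact: bounded_measurable_integrable].
by rewrite -expectation_mean// unlock.
Qed.

End expectation_bounded.

(** * Associated indicators *)

Section hits.
Context (d : measure_display) (T : measurableType d) (R : realType)
  (P : probability T R) (Z : nat -> {RV P >-> R}).

(** A threshold indicator is used, rather than the test Z i w = 1, because it is
    nondecreasing in Z i, as association requires; the two agree almost surely
    for Bernoulli variables. *)
Definition hit (i : nat) (w : T) : bool := 1 <= Z i w.

Definition hits (j : nat) (w : T) : nat := (\sum_(i < j) hit i w)%N.

Lemma hitsS j w : hits j.+1 w = (hits j w + hit j w)%N.
Proof. by rewrite /hits big_ord_recr. Qed.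

Lemma hits_le j w : (hits j w <= j)%N.
Proof.
elim: j => [|j IH]; first by rewrite /hits big_ord0.
by rewrite hitsS -addn1 leq_add// leq_b1.
Qed.

Lemma measurable_hit i : measurable_fun setT (hit i).
Proof. by apply: measurable_fun_ler => //; exact: measurable_funPT. Qed.

(** The number of hits takes finitely many values, so f is bounded on them;
    measurability follows by splitting on whether the last variable hits. *)
Lemma bounded_measurable_hits (f : nat -> R) j :
  bounded_measurable (fun w => f (hits j w)).
Proof.
split; last first.
  exists (\sum_(a < j.+1) `|f a|) => w; have := hits_le j w.
  rewrite -ltnS => h; rewrite (bigD1 (Ordinal h))//= lerDl sumr_ge0//.
elim: j f => [|j IH] f.
  by apply: (eq_measurable_fun (fun=> f 0%N)) => // w _; rewrite /hits big_ord0.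
apply: (eq_measurable_fun
    (fun w => if hit j w then f (hits j w).+1 else f (hits j w))).
  by move=> w _; rewrite hitsS; case: hit; rewrite ?addn1 ?addn0.
apply: measurable_fun_ifT; first exact: measurable_hit.
  exact: (IH (fun a => f a.+1)).
exact: IH.
Qed.

Lemma bounded_measurable_hit i : bounded_measurable (fun w => (hit i w)%:R : R).
Proof.
split; last by exists 1 => w; case: hit; rewrite ?normr1 ?normr0.
apply: (eq_measurable_fun (fun w => if hit i w then 1 else 0 : R)).
  by move=> w _; case: hit.
by apply: measurable_fun_ifT => //; exact: measurable_hit.
Qed.

(** Association applied to two nondecreasing functions of the whole row: f of
    the number of hits before j, and the indicator of a hit at j. *)
Lemma rcov_hits_nondecreasing N (assoc : associated (fun i : 'I_N => Z i))
    (f : nat -> R) j : (j < N)%N -> {homo f : a b / (a <= b)%N >-> a <= b} ->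
  0 <= rcov P (fun w => f (hits j w)) (fun w => (hit j w)%:R).
Proof.
move=> jN fh.
pose h (x : N.-tuple R) := f (\sum_(i < j) (1 <= nth 0 x i)%R)%N.
pose g (x : N.-tuple R) : R := ((1 <= nth 0 x j)%R)%:R.
have nthZ i w : (i < N)%N -> nth 0 [tuple Z i w | i < N] i = Z i w.
  by move=> iN; rewrite -[i]/(val (Ordinal iN)) -tnth_nth tnth_mktuple.
have hE : (fun w => h [tuple Z i w | i < N]) = (fun w => f (hits j w)).
  apply/funext => w; rewrite /h /hits; congr f; apply: eq_bigr => i _.
  by rewrite nthZ// (ltn_trans (ltn_ord i)).
have gE : (fun w => g [tuple Z i w | i < N]) = (fun w => (hit j w)%:R).
  by apply/funext => w; rewrite /g nthZ.
have bh := bounded_measurable_hits f j.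
have bg := bounded_measurable_hit j.
have le_ind (x y : R) : x <= y -> ((1 <= x)%R <= (1 <= y)%R)%N.
  by move=> xy; case: (leP 1 x) => // /le_trans/(_ xy) ->.
have nth_le (x y : N.-tuple R) : (forall i, tnth x i <= tnth y i) ->
    forall i, (i < N)%N -> nth 0 x i <= nth 0 y i.
  by move=> xy i iN; have := xy (Ordinal iN); rewrite !(tnth_nth 0).
have := assoc h g; cbv zeta; rewrite hE gE
  (covariance_rcov P bh bg) lee_fin; apply.
- move=> x y xy; apply: fh; apply: leq_sum => i _; apply: le_ind.
  by apply: nth_le => //; rewrite (ltn_trans (ltn_ord i)).
- by move=> x y xy; rewrite ler_nat; apply: le_ind; exact: nth_le.
- exact: bounded_measurable_Lfun.
- exact: bounded_measurable_Lfun.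
- exact/bounded_measurable_Lfun/bounded_measurableM.
Qed.

Lemma rcov_hits_sum j i :
  rcov P (fun w => (hits j w)%:R) (fun w => (hit i w)%:R) =
  \sum_(a < j) rcov P (fun w => (hit a w)%:R) (fun w => (hit i w)%:R).
Proof.
elim: j => [|j IH].
  rewrite big_ord0 -[RHS](rcov_cstl P 0 (bounded_measurable_hit i)).
  by congr rcov; apply/funext => w; rewrite /hits big_ord0.
rewrite big_ord_recr/= -IH -rcovDl;
  [|exact: (bounded_measurable_hits (fun a => a%:R))|exact: bounded_measurable_hit..].
by congr rcov; apply/funext => w; rewrite hitsS natrD.
Qed.

(** L u + f u and L u - f u are nondecreasing in u, so association bounds the
    covariance of f of the number of hits, from both sides, by L times the
    covariance of the number of hits itself. *)
Lemma rcov_hits_lipschitz N (assoc : associated (fun i : 'I_N => Z i))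
    (f : nat -> R) (L : R) j : (j < N)%N -> (forall a, `|f a.+1 - f a| <= L) ->
  `|rcov P (fun w => f (hits j w)) (fun w => (hit j w)%:R)| <=
  L * \sum_(a < j) rcov P (fun w => (hit a w)%:R) (fun w => (hit j w)%:R).
Proof.
move=> jN fL; rewrite -rcov_hits_sum.
have bf := bounded_measurable_hits f j.
have bi := bounded_measurable_hits (fun a => a%:R) j.
have bh := bounded_measurable_hit j.
have bcM c g : bounded_measurable g ->
    bounded_measurable (fun w => c * g w : R).
  by move=> bg; apply: bounded_measurableM => //; exact: bounded_measurable_cst.
have key e : `|e| = 1 :> R -> 0 <=
    rcov P (fun w => L * (hits j w)%:R + e * f (hits j w))
      (fun w => (hit j w)%:R).
  move=> e1; apply: (@rcov_hits_nondecreasing N assoc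
    (fun a => L * a%:R + e * f a)) => //.
  apply: homo_leq => //; first exact: le_trans.
  move=> a; have : `|e * (f a.+1 - f a)| <= L by rewrite normrM e1 mul1r.
  rewrite -natr1 ler_norml => /andP[]; lra.
have := key 1 (normr1 _); have := key (-1) (normrN1 _).
rewrite !rcovDl ?rcovZl//; [|exact: bcM..].
by rewrite ler_norml => ? ?; apply/andP; split; lra.
Qed.

(** Since a hit B is 0 or 1, f (U + B) = f U + (f (U + 1) - f U) B. *)
Lemma mean_hitsS (f : nat -> R) p j : mean P (fun w => (hit j w)%:R) = p ->
  mean P (fun w => f (hits j.+1 w)) =
  mean P (fun w => bernoulli_step p f (hits j w)) +
  rcov P (fun w => f (hits j w).+1 - f (hits j w)) (fun w => (hit j w)%:R).
Proof.
move=> hp; pose D a := f a.+1 - f a.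
have bf := bounded_measurable_hits f j.
have bD := bounded_measurable_hits D j.
have bh := bounded_measurable_hit j.
rewrite (_ : (fun w => f (hits j.+1 w)) =
    fun w => f (hits j w) + D (hits j w) * (hit j w)%:R); last first.
  apply/funext => w; rewrite hitsS /D; case: hit; rewrite ?addn1 ?addn0.
    by rewrite mulr1 addrC subrK.
  by rewrite mulr0 addr0.
rewrite meanD//; last exact: bounded_measurableM.
rewrite /bernoulli_step meanD//; last first.
  by apply: bounded_measurableM => //; exact: bounded_measurable_cst.
rewrite meanZ// /rcov hp -/(D _); ring.
Qed.

(** Induction on j with f varying: the first term of [mean_hitsS] is the
    induction hypothesis for the function [bernoulli_step p f], which has the
    same bound M, and its covariance term is the new summand. The constant 4
    arises because the increments of f are themselves differenced. *)
Lemma mean_hits_bernoulli N (assoc : associated (fun i : 'I_N => Z i)) (p : R) :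
  0 <= p <= 1 ->
  (forall j, (j < N)%N -> mean P (fun w => (hit j w)%:R) = p) ->
  forall (f : nat -> R) (M : R) j, (j <= N)%N -> (forall a, `|f a| <= M) ->
  `|mean P (fun w => f (hits j w)) - iter j (bernoulli_step p) f 0%N| <=
  4 * M * \sum_(i < j) \sum_(a < i)
    rcov P (fun w => (hit a w)%:R) (fun w => (hit i w)%:R).
Proof.
move=> p01 hp f M j; elim: j f => [|j IH] f jN fM.
  rewrite big_ord0 mulr0 /= /hits.
  under eq_fun do rewrite big_ord0.
  rewrite /mean Rintegral_cst// [X in fine X](@probability_setT _ _ _ P).
  by rewrite mulr1 subrr normr0.
rewrite (mean_hitsS f (hp j jN)) iterSr big_ord_recr/= mulrDr addrAC.
rewrite (le_trans (ler_normD _ _))// lerD//.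
  by apply: IH; [exact: ltnW|exact: bernoulli_step_bounded].
apply: (@rcov_hits_lipschitz N assoc (fun a => f a.+1 - f a) (4 * M)) => // a.
have := fM a; have := fM a.+1; have := fM a.+2; rewrite !ler_norml.
by move=> /andP[? ?] /andP[? ?] /andP[? ?]; apply/andP; split; lra.
Qed.

End hits.

(** * Stationary Bernoulli rows *)

Section bernoulli_row.
Context (d : measure_display) (T : measurableType d) (R : realType)
  (P : probability T R) (Z : nat -> {RV P >-> R}) (N : nat) (p : R).
Hypothesis Z_bernoulli : forall i, (i < N)%N -> has_bernoulli_law (Z i) p.

Lemma bernoulli_hit i : (i < N)%N -> {ae P, forall w, Z i w = (hit Z i w)%:R}.
Proof.
move=> iN; have [Z1 Z0] := Z_bernoulli iN.
have mZ (c : R) : measurable (Z i @^-1` [set c]).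
  by rewrite -[X in measurable X]setTI; exact: measurable_funPT.
pose A := Z i @^-1` [set 1] `|` Z i @^-1` [set 0].
have mA : measurable A by exact: measurableU.
have PA : P A = 1%E.
  rewrite measureU//; last first.
    by apply/seteqP; split=> // w [/= -> /eqP]; rewrite oner_eq0.
  by rewrite [X in (X + _)%E]Z1 [X in (_ + X)%E]Z0 -EFinD addrC subrK.
exists (~` A); split; first exact: measurableC.
  by rewrite probability_setC// PA subee.
move=> w /= Zw Aw; apply: Zw; rewrite /hit; case: Aw => /= ->.
  by rewrite lexx.
by rewrite ler10.
Qed.

Lemma sum_bernoulli_hits j : (j <= N)%N ->
  {ae P, forall w, \sum_(i < j) Z i w = (hits Z j w)%:R}.
Proof.
elim: j => [|j IH] jN.
  by apply: aeW => w; rewrite /hits !big_ord0.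
apply: filterS2 (IH (ltnW jN)) (bernoulli_hit jN) => w sw Zw.
by rewrite big_ord_recr/= sw Zw hitsS natrD.
Qed.

Lemma mean_hit i : (i < N)%N -> mean P (fun w => (hit Z i w)%:R) = p.
Proof.
move=> iN; have [Z1 Z0] := Z_bernoulli iN.
have mZ : measurable (Z i @^-1` [set 1]).
  by rewrite -[X in measurable X]setTI; exact: measurable_funPT.
apply: EFin_inj; rewrite -expectation_mean; last exact: bounded_measurable_hit.
rewrite (@expectation_ae_eq _ _ _ P _ \1_(Z i @^-1` [set 1])).
- by rewrite expectation_indic.
- by case: (@bounded_measurable_hit _ _ _ P Z i).
- exact: measurable_indic.
- apply: filterS (bernoulli_hit iN) => w Zw; rewrite indicE -Zw.
  case: (boolP (w \in _)) => [|/negP wZ]; first by rewrite inE.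
  move: Zw; case: hit => // Zw; exfalso; apply: wZ; rewrite inE/=; exact: Zw.
Qed.

Hypothesis Z_stationary : stationary (fun i : 'I_N => Z i).

(** Stationarity for pairs: the joint probability of two hits is the law of a
    pair of the row evaluated on the set where both coordinates are at least
    1, and shifting by a preserves it. *)
Lemma rcov_hit_shift a i : (a <= i)%N -> (i < N)%N ->
  rcov P (fun w => (hit Z a w)%:R) (fun w => (hit Z i w)%:R) =
  rcov P (fun w => (hit Z 0 w)%:R) (fun w => (hit Z (i - a) w)%:R).
Proof.
move=> ai iN; have N0 : (0 < N)%N by exact: leq_trans iN.
have aN : (a < N)%N by exact: leq_ltn_trans iN.
have iaN : (i - a < N)%N by apply: leq_ltn_trans iN; exact: leq_subr.
rewrite /rcov !mean_hit//; congr (_ - _).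
pose A : set (2.-tuple R) :=
  [set x | 1 <= tnth x ord0] `&` [set x | 1 <= tnth x ord_max].
have mA : measurable A.
  have mI (e : 'I_2) : measurable [set x : 2.-tuple R | 1 <= tnth x e].
    rewrite -[X in measurable X]setTI.
    rewrite (_ : [set x | _] =
      (fun x : 2.-tuple R => tnth x e) @^-1` `[1, +oo[); last first.
      by apply/seteqP; split=> x /=; rewrite in_itv/= andbT.
    exact: measurable_tnth.
  exact: measurableI.
have joint b c (bN : (b < N)%N) (cN : (c < N)%N) :
    (mean P (fun w => (hit Z b w)%:R * (hit Z c w)%:R))%:E =
    pushforward P (fun w => [tuple
      Z ((if e == ord0 then Ordinal bN else Ordinal cN) : 'I_N) w | e < 2]) A.
  rewrite -expectation_mean; last first.
    by apply: bounded_measurableM; exact: bounded_measurable_hit.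
  rewrite (_ : (fun w => _) = \1_([set w | hit Z b w] `&` [set w | hit Z c w])).
    rewrite expectation_indic; last first.
      apply: measurableI; rewrite -[X in measurable X]setTI;
        exact: measurable_hit.
    congr (P _); apply/seteqP; split => w /=; rewrite /A/= !tnth_mktuple//=.
  apply/funext => w; rewrite indicE in_setI -natrM.
  have memE e : (w \in [set w | hit Z e w]) = hit Z e w.
    by apply/idP/idP; rewrite inE.
  by rewrite !memE; case: hit; case: hit.
apply: EFin_inj.
rewrite (joint a i aN iN) (joint 0%N (i - a)%N N0 iaN).
apply: (Z_stationary (s := a)) => // e.
case: ifP => _ /=; first by rewrite add0n.
by rewrite subnK.
Qed.

Lemma covariance_hit i : (i < N)%N -> (0 < N)%N ->
  covariance P (Z 0%N) (Z i) =
  (rcov P (fun w => (hit Z 0 w)%:R) (fun w => (hit Z i w)%:R))%:E.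
Proof.
move=> iN N0; apply: covariance_ae_eq.
- exact: measurable_funPT.
- exact: measurable_funPT.
- exact: bounded_measurable_hit.
- exact: bounded_measurable_hit.
- exact: bernoulli_hit.
- exact: bernoulli_hit.
Qed.

(** By stationarity the covariance of a pair depends on the lag i - a alone, and
    lag j - 1 occurs N - j + 1 times among the pairs a < i < N. *)
Lemma sum_rcov_hit :
  (\sum_(2 <= j < N.+1)
     ((N - j + 1)%N%:R%:E * covariance P (Z 0%N) (Z j.-1)) =
   (\sum_(i < N) \sum_(a < i)
      rcov P (fun w => (hit Z a w)%:R) (fun w => (hit Z i w)%:R))%:E)%E.
Proof.
pose c i := rcov P (fun w => (hit Z 0 w)%:R) (fun w => (hit Z i w)%:R).
rewrite (eq_big_nat _ _
    (F2 := fun j => ((N - j + 1)%N%:R * c j.-1)%:E)); last first.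
  move=> j /andP[j2 jN]; rewrite EFinM covariance_hit//; last by lia.
  by lia.
rewrite sumEFin; congr EFin.
transitivity (\sum_(i < N) \sum_(a < i) c (i - a)%N); last first.
  apply: eq_bigr => i _; apply: eq_bigr => a _.
  by rewrite /c [RHS]rcov_hit_shift// ltnW.
elim: N => [|n IH]; first by rewrite big_ord0 big_geq.
rewrite big_ord_recr/= -IH.
have [->|n0] := posnP n; first by rewrite big_ord0 !big_geq// addr0.
rewrite big_nat_recr//= (eq_big_nat _ _
    (F2 := fun j => (n - j + 1)%N%:R * c j.-1 + c j.-1)); last first.
  move=> j /andP[j2 jn].
  rewrite -{3}[c j.-1]mul1r -mulrDl natr1; congr (_%:R * _).
  by lia.
rewrite big_split/= -addrA; congr (_ + _).
rewrite subnn add0n mul1r -(big_mkord xpredT (fun a => c (n - a)%N)).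
transitivity (\sum_(1 <= a < n.+1) c a).
  by rewrite [RHS]big_nat_recr// big_add1.
rewrite big_add1 big_nat_rev/=; apply: eq_big_nat => a /andP[_ an].
by congr c; lia.
Qed.

End bernoulli_row.

(** * Poisson convergence *)

Theorem theorem4 (d : measure_display) (T : measurableType d) (R : realType)
    (P : probability T R) (X : nat -> nat -> {RV P >-> R})
    (k m l r : nat -> nat) (p : nat -> R) (lambda1 : R)
    (k_oo : k n @[n --> \oo] --> \oo)
    (row_stationary : forall n, (1 <= n)%N -> stationary (array_row X k n))
    (row_associated : forall n, (1 <= n)%N -> associated (array_row X k n))
    (k_decomp : forall n, (1 <= n)%N -> k n = (m n * l n + r n)%N)
    (m_ge1 : forall n, (1 <= n)%N -> (1 <= m n)%N)
    (m_oo : m n @[n --> \oo] --> \oo)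
    (r_lt_l : forall n, (1 <= n)%N -> (r n < l n)%N)
    (l_over_m : ((l n)%:R / (m n)%:R : R) @[n --> \oo] --> (0 : R))
    (X_bernoulli : forall n j, (1 <= n)%N -> (1 <= j <= k n)%N ->
       has_bernoulli_law (X j n) (p n))
    (p_itv : forall n, (1 <= n)%N -> 0 < p n < 1)
    (p_0 : p n @[n --> \oo] --> (0 : R))
    (kp_lambda1 : ((k n)%:R * p n) @[n --> \oo] --> lambda1)
    (lambda1_gt0 : 0 < lambda1)
    (cov_sum_0 :
       (2%:E * \sum_(2 <= j < (k n).+1)
          ((k n - j + 1)%N%:R%:E * covariance P (X 1%N n) (X j n)))%E
         @[n --> \oo] --> 0%E)
    (cov_sup_0 :
       ((m n * l n ^ 2)%N%:R%:E *
          ereal_sup [set covariance P (X 1%N n) (X j n) |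
                     j in [set j | (2 <= j <= k n)%N]])%E
         @[n --> \oo] --> 0%E) :
  cvg_weakly (fun n => distribution P (row_sum X k n)) (poisson_law lambda1).
Proof.
pose Z n i : {RV P >-> R} := X i.+1 n.
pose S n := \sum_(i < k n) \sum_(a < i)
  rcov P (fun w => (hit (Z n) a w)%:R) (fun w => (hit (Z n) i w)%:R).
have Zb n : (1 <= n)%N ->
    forall i, (i < k n)%N -> has_bernoulli_law (Z n i) (p n).
  by move=> n1 i ik; apply: X_bernoulli.
have S0 : S n @[n --> \oo] --> (0 : R).
  have SE n : (1 <= n)%N -> (2%:E * \sum_(2 <= j < (k n).+1)
      ((k n - j + 1)%N%:R%:E * covariance P (X 1%N n) (X j n)))%E =
      (2 * S n)%:E.
    move=> n1; rewrite EFinM -(sum_rcov_hit (Zb n n1) (row_stationary n n1)).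
    congr (_ * _)%E; apply: eq_big_nat => j /andP[j2 _].
    by rewrite /Z prednK//; lia.
  have lim : (2 * S n)%:E @[n --> \oo] --> (0 : R)%:E.
    apply: cvg_trans cov_sum_0; apply: near_eq_cvg; near=> n.
    by apply: SE; near: n; exact: nbhs_infty_ge.
  have {}lim : 2^-1 * (2 * S n) @[n --> \oo] --> 2^-1 * (0 : R).
    by apply: cvgMr; exact: (fine_cvg lim).
  rewrite mulr0 in lim; apply: cvg_trans lim; apply: near_eq_cvg; near=> n.
  by rewrite mulKf.
move=> f cf [M fM].
have mf : measurable_fun setT f by exact: continuous_measurable_fun.
pose F (j : nat) : R := f j%:R.
have FM j : `|F j| <= M by exact: fM.
pose u n := mean P (fun w => F (hits (Z n) (k n) w)).
pose v n := \sum_(j < (k n).+1) binomial_pmf (k n) (p n) j * F j.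
have limv : (v n)%:E @[n --> \oo] -->
    (\int[poisson_prob lambda1 0]_j (F j)%:E)%E.
  (* row 0 is arbitrary, so the sequences are shifted by one *)
  rewrite -(cvg_shiftS (fun n => (v n)%:E)).
  apply: (cvg_binomial_poisson lambda1_gt0
    (k := fun n => k n.+1) (p := fun n => p n.+1)).
  - by rewrite (cvg_shiftS k).
  - by move=> n; exact: p_itv.
  - by rewrite (cvg_shiftS p).
  - by rewrite (cvg_shiftS (fun n => (k n)%:R * p n)).
  - exact: FM.
have uv n : (1 <= n)%N -> `|u n - v n| <= 4 * M * S n.
  move=> n1; have p01 : 0 <= p n <= 1.
    by have /andP[/ltW -> /ltW ->] := p_itv n n1.
  have := mean_hits_bernoulli (row_associated n n1) p01
    (mean_hit (Zb n n1)) (leqnn _) FM.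
  by rewrite iter_bernoulli_step.
have limuv : (u n - v n) @[n --> \oo] --> (0 : R).
  have limS : 4 * M * S n @[n --> \oo] --> (0 : R).
    by rewrite -[X in _ --> X](mulr0 (4 * M)); exact: cvgMr.
  apply/norm_cvg0P; apply: (squeeze_cvgr _ (cvg_cst 0) limS); near=> n.
  by rewrite normr_ge0 uv//; near: n; exact: nbhs_infty_ge.
have limE : (\int[poisson_law lambda1]_x (f x)%:E =
    \int[poisson_prob lambda1 0]_j (F j)%:E)%E.
  rewrite integral_distribution_mean//; last by exists M.
  rewrite -expectation_mean; first by rewrite unlock.
  by split=> //; exists M => j; exact: fM.
rewrite limE.
have limu : ((u n - v n)%:E + (v n)%:E)%E @[n --> \oo] -->
    (0%:E + \int[poisson_prob lambda1 0]_j (F j)%:E)%E.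
  by apply: cvgeD => //; apply: cvg_EFin => //; near=> n.
rewrite add0e in limu; apply: cvg_trans limu; apply: near_eq_cvg; near=> n.
have n1 : (1 <= n)%N by near: n; exact: nbhs_infty_ge.
rewrite /= -EFinD subrK.
rewrite integral_distribution_mean//; last by exists M.
rewrite /u -!expectation_mean.
- apply: expectation_ae_eq.
  + by case: (bounded_measurable_hits (Z n) F (k n)).
  + by apply: measurableT_comp => //; exact: measurable_funPT.
  + apply: filterS (sum_bernoulli_hits (Zb n n1) (leqnn _)) => w sw.
    by rewrite /F -sw /= /row_sum big_add1 big_mkord.
- exact: bounded_measurable_hits.
- split; last by exists M => w; exact: fM.
  by apply: measurableT_comp => //; exact: measurable_row_sum.
Unshelve. all: by end_near. Qed.
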